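(* Let $(G,\oplus)$ be a gyrogroup. For $a\in G$ let $L_a\colon G\to G$, $L_a(x)=a\oplus x$, be the left gyrotranslation by $a$, and let $\overline{G}=\{L_a : a\in G\}$. (1) Each left gyrotranslation $L_a$ is a permutation of $G$. (2) The map $\psi\colon G\to\overline{G}$, $\psi(a)=L_a$, is bijective. Consequently, with $\phi:=\psi^{-1}\colon\overline{G}\to G$, the set $\overline{G}$ endowed with the induced operation $X\oplus_{\overline{G}}Y:=\phi^{-1}(\phi(X)\oplus\phi(Y))$ is a gyrogroup, and this operation is given by $L_a\oplus_{\overline{G}}L_b=L_{a\oplus b}$ for all $a,b\in G$. (3) For all $a,b,c\in G$, $$L_a\circ L_b=L_{a\oplus b}\circ\mathrm{gyr}[a,b]$$ and $$\mathrm{gyr}_{\overline{G}}[L_a,L_b]L_c=L_{\mathrm{gyr}[a,b]c},$$ where $\mathrm{gyr}_{\overline{G}}$ denotes the gyroautomorphisms of the gyrogroup $(\overline{G},\oplus_{\overline{G}})$.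
   Context: A gyrogroup is a nonempty set $G$ with a binary operation $\oplus$ such that: (G1) there is $0\in G$ with $0\oplus a=a$ for all $a$; (G2) for each $a$ there is $b$ with $b\oplus a=0$; (G3) for all $a,b\in G$ there is an automorphism $\mathrm{gyr}[a,b]$ of $(G,\oplus)$ (a bijection $G\to G$ preserving $\oplus$) with $a\oplus(b\oplus c)=(a\oplus b)\oplus\mathrm{gyr}[a,b]c$ for all $c\in G$; (G4) $\mathrm{gyr}[a,b]=\mathrm{gyr}[a\oplus b,b]$ for all $a,b\in G$. It is known that $0$ is then a two-sided identity, every $a$ has a two-sided inverse $\ominus a$, and the gyroautomorphisms are determined by $\mathrm{gyr}[a,b]c=\ominus(a\oplus b)\oplus(a\oplus(b\oplus c))$. It is also known that if $\phi\colon X\to G$ is a bijection from a set $X$ onto a gyrogroup $G$, then $X$ with $x\oplus_X y:=\phi^{-1}(\phi(x)\oplus\phi(y))$ is a gyrogroup. *)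

(* Defs.v *)
From mathcomp Require Import all_boot.

Set Implicit Arguments.
Unset Strict Implicit.
Unset Printing Implicit Defensive.

Definition gyr_automorphism (T : Type) (op : T -> T -> T) (f : T -> T) : Prop :=
  bijective f /\ {morph f : x y / op x y}.

(* [is_gyrogroup op gyr]: (T, op) is a gyrogroup whose gyroautomorphisms are
   [gyr a b]. The axioms determine [gyr] from [op], so the gyrogroups with
   operation [op] are expressed by [exists gyr, is_gyrogroup op gyr], and "the
   gyroautomorphisms of (T, op)" by any [gyr] with [is_gyrogroup op gyr].
   Nonemptiness of T follows from the first axiom. *)
Record is_gyrogroup (T : Type) (op : T -> T -> T) (gyr : T -> T -> T -> T) :
    Prop := IsGyrogroup {
  gyro_id_inv : exists zero : T,
    (forall a, op zero a = a) /\ (forall a, exists b, op b a = zero);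
  gyro_aut : forall a b, gyr_automorphism op (gyr a b);
  gyro_assoc : forall a b c, op a (op b c) = op (op a b) (gyr a b c);
  gyro_loop : forall a b, gyr a b = gyr (op a b) b
}.

Definition ltrans (G : Type) (op : G -> G -> G) (a : G) : G -> G :=
  fun x => op a x.

Definition ltrans_set (G : Type) (op : G -> G -> G) : Type :=
  {f : G -> G | exists a, f = ltrans op a}.

Definition to_ltrans (G : Type) (op : G -> G -> G) (a : G) : ltrans_set op :=
  exist _ (ltrans op a) (ex_intro _ a erefl).

(* [phi_inv] is meant to be the two-sided inverse of [phi]. *)
Definition induced_op (X G : Type) (op : G -> G -> G)
    (phi : X -> G) (phi_inv : G -> X) : X -> X -> X :=
  fun x y => phi_inv (op (phi x) (phi y)).

(* Main.v *)
Require Import Defs.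
From mathcomp Require Import all_boot.
From Stdlib Require Import FunctionalExtensionality.

Set Implicit Arguments.
Unset Strict Implicit.
Unset Printing Implicit Defensive.

(** The key fact is the left cancellation law [op b (op a c) = c] whenever [b]
    is a left inverse of [a] ([gyro_left_cancel]).  Gyroassociativity gives
    [op b (op a c) = gyr b a c], which already makes left translations
    injective; the loop property then turns [gyr b a] into [gyr 0 a], and the
    latter is the identity because [0] is a left identity.  The law yields in
    turn that [0] is a right identity and that left inverses are two-sided, so
    the translation by [b] is a two-sided inverse of the translation by [a].

    Since [op a 0 = a], evaluation at [0] recovers [a] from its left
    translation, so [to_ltrans] is bijective.  The composition formula is
    gyroassociativity read as an equality of functions.  A gyrogroup structure
    can be carried along any bijection ([is_gyrogroup_induced]), and
    gyroautomorphisms are determined by the operation ([gyr_unique]); hence the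
    gyroautomorphisms of the set of left translations are the carried ones. *)

Section Gyrogroup.

Variables (G : Type) (op : G -> G -> G) (gyr : G -> G -> G -> G).
Hypothesis hG : is_gyrogroup op gyr.

Lemma gyr_inj a b : injective (gyr a b).
Proof. by have [/bij_inj] := gyro_aut hG a b. Qed.

(** Applying a left inverse [x] of [a] to [op a b] gives [gyr x a b], and
    gyroautomorphisms are injective. *)
Lemma gyro_addI a : injective (op a).
Proof.
have [zero [add0 invl]] := gyro_id_inv hG.
have [x xa0] := invl a => b c eq_ab_ac.
apply: (@gyr_inj x a).
by rewrite -[LHS]add0 -[RHS]add0 -xa0 -!(gyro_assoc hG) eq_ab_ac.
Qed.

Section Identity.

Variable zero : G.
Hypothesis add0 : forall a, op zero a = a.

Lemma gyr0 a c : gyr zero a c = c.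
Proof.
by apply: (@gyro_addI a); rewrite -{1}[a]add0 -(gyro_assoc hG) add0.
Qed.

(** The loop property replaces [gyr b a] by [gyr (op b a) a = gyr zero a]. *)
Lemma gyro_left_cancel a b : op b a = zero -> cancel (op a) (op b).
Proof.
by move=> ba0 c; rewrite (gyro_assoc hG) (gyro_loop hG) ba0 add0 gyr0.
Qed.

Hypothesis invl : forall a, exists b, op b a = zero.

(** Both [a] and [op a zero] are sent to [zero] by a left inverse of [a]. *)
Lemma gyro_add_r0 a : op a zero = a.
Proof.
have [b ba0] := invl a.
by apply: (@gyro_addI b); rewrite (gyro_left_cancel ba0) ba0.
Qed.

Lemma gyro_inv_sym a b : op b a = zero -> op a b = zero.
Proof.
move=> ba0; apply: (@gyro_addI b).
by rewrite (gyro_left_cancel ba0) gyro_add_r0.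
Qed.

End Identity.

Lemma ltrans_bij a : bijective (ltrans op a).
Proof.
have [zero [add0 invl]] := gyro_id_inv hG.
have [b ba0] := invl a.
exists (ltrans op b); apply: (gyro_left_cancel add0) => //.
exact: (gyro_inv_sym add0 invl).
Qed.

Lemma to_ltrans_bij : bijective (to_ltrans op).
Proof.
have [zero [add0 invl]] := gyro_id_inv hG.
have add_r0 := gyro_add_r0 add0 invl.
exists (fun f => sval f zero) => [a | [f [a def_f]]]; first exact: add_r0.
(* Once [f] is replaced by [ltrans op a], its membership proof is literally the
   one stored by [to_ltrans op a], so both sides agree as dependent pairs. *)
by subst f; rewrite /= /ltrans add_r0.
Qed.

Lemma ltrans_comp a b :
  ltrans op a \o ltrans op b = ltrans op (op a b) \o gyr a b.
Proof. by apply: functional_extensionality => c; apply: gyro_assoc hG a b c. Qed.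

(** Gyroassociativity determines [op (op a b) (gyr a b c)], and [op a b] can be
    cancelled on the left. *)
Lemma gyr_unique gyr' : is_gyrogroup op gyr' ->
  forall a b c, gyr' a b c = gyr a b c.
Proof.
move=> hG' a b c; apply: (@gyro_addI (op a b)).
by rewrite -(gyro_assoc hG') (gyro_assoc hG).
Qed.

Section Transport.

Variables (X : Type) (phi : X -> G) (psi : G -> X).
Hypotheses (psiK : cancel psi phi) (phiK : cancel phi psi).

Lemma induced_opE a b : induced_op op phi psi (psi a) (psi b) = psi (op a b).
Proof. by rewrite /induced_op !psiK. Qed.

Lemma is_gyrogroup_induced :
  is_gyrogroup (induced_op op phi psi)
    (fun x y z => psi (gyr (phi x) (phi y) (phi z))).
Proof.
split=> [| x y | x y z | x y].
- have [zero [add0 invl]] := gyro_id_inv hG.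
  exists (psi zero); split=> x; first by rewrite /induced_op psiK add0.
  have [b bx0] := invl (phi x).
  by exists (psi b); rewrite /induced_op psiK bx0.
- have [[g gyrK gK] gyrD] := gyro_aut hG (phi x) (phi y).
  split; last by move=> u v /=; rewrite /induced_op !psiK gyrD.
  by exists (psi \o g \o phi) => z /=; rewrite psiK ?gyrK ?gK phiK.
- by rewrite /induced_op !psiK (gyro_assoc hG).
- by rewrite /induced_op psiK -(gyro_loop hG).
Qed.

End Transport.

End Gyrogroup.

Theorem theorem3p1 (G : Type) (op : G -> G -> G) (gyr : G -> G -> G -> G)
    (hG : is_gyrogroup op gyr) :
  (forall a : G, bijective (ltrans op a)) /\
  bijective (to_ltrans op) /\
  (forall a b : G,
     ltrans op a \o ltrans op b = ltrans op (op a b) \o gyr a b) /\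
  (forall phi : ltrans_set op -> G,
     cancel (to_ltrans op) phi -> cancel phi (to_ltrans op) ->
     let opbar := induced_op op phi (to_ltrans op) in
     (exists gyrbar, is_gyrogroup opbar gyrbar) /\
     (forall a b : G,
        opbar (to_ltrans op a) (to_ltrans op b) = to_ltrans op (op a b)) /\
     (forall gyrbar, is_gyrogroup opbar gyrbar ->
        forall a b c : G,
        gyrbar (to_ltrans op a) (to_ltrans op b) (to_ltrans op c)
        = to_ltrans op (gyr a b c))).
Proof.
split; first exact: ltrans_bij hG.
split; first exact: to_ltrans_bij hG.
split; first exact: ltrans_comp hG.
move=> phi psiK phiK opbar.
have hGbar := is_gyrogroup_induced hG psiK phiK.
split; first by eexists; exact: hGbar.
split=> [a b | gyrbar hgyrbar a b c]; first exact: induced_opE psiK a b.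
by rewrite (gyr_unique hGbar hgyrbar) !psiK.
Qed.
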